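(* Let $G=\mathrm{Iso}(\mathbb{U}_1)$ be the isometry group of the Urysohn sphere. Then every function in $\mathrm{Tame}(G)\cap\mathrm{UC}(G)$ is constant.
   Context: The Urysohn sphere $\mathbb{U}_1$ is the unique (up to isometry) separable complete metric space of diameter $1$ that is homogeneous (every isometry between finite subsets extends to a global isometry) and contains an isometric copy of every countable metric space of diameter at most $1$. $\mathrm{Iso}(\mathbb{U}_1)$ carries the topology of pointwise convergence. $\mathrm{UC}(G)$ denotes the bounded continuous functions $h$ on $G$ that are both right uniformly continuous (for every $\epsilon>0$ there is a neighborhood $U$ of $1$ with $|h(g^{-1}x)-h(x)|<\epsilon$ for all $x\in G$, $g\in U$) and left uniformly continuous (with $|h(xg)-h(x)|<\epsilon$ instead). $G$ acts on itself by left translation and on functions by $(gh)(x)=h(g^{-1}x)$. A compactification of the $G$-space $G$ is a continuous $G$-map $\nu\colon G\to Y$ with dense image into a compact Hausdorff $G$-space; $h$ comes from $\nu$ if $h=\tilde h\circ\nu$ with $\tilde h$ continuous on $Y$. $h$ is tame ($h\in\mathrm{Tame}(G)$) if it comes from a Rosenthal-representable compactification; equivalently, if it comes from a compactification $\nu\colon G\to Y$ such that the orbit $G\tilde h$ is sequentially precompact in $\mathbb{R}^Y$ (every sequence has a pointwise convergent subsequence). *)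

(* Defs.v *)
From HB Require Import structures.
From mathcomp Require Import all_boot all_order all_algebra.
From mathcomp Require Import all_classical all_reals all_analysis.

Set Implicit Arguments.
Unset Strict Implicit.
Unset Printing Implicit Defensive.

Import Order.TTheory GRing.Theory Num.Theory.
Import numFieldNormedType.Exports.

Local Open Scope classical_set_scope.
Local Open Scope ring_scope.

HB.mixin Record isTopologicalGroup G & Topological G & Group G := {
  mulg_continuous : continuous (fun p : G * G => (p.1 * p.2)%g) ;
  invg_continuous : continuous (fun g : G => (g^-1)%g)
}.

#[short(type="topologicalGroupType")]
HB.structure Definition TopologicalGroup :=
  { G of Topological G & Group G & isTopologicalGroup G }.

Section isometry_group.
Context {R : realType} (U : metricType R).

Definition isometries : set {ptws U -> U} :=
  [set g | (forall x y, mdist (g x) (g y) = mdist x y) /\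
           (forall y, exists x, g x = y)].

Definition Iso : Type := set_type isometries.

HB.instance Definition _ := Topological.copy Iso (set_type isometries).

Definition iso_fun (g : Iso) : U -> U := set_val g.

Lemma iso_mdist (g : Iso) x y : mdist (iso_fun g x) (iso_fun g y) = mdist x y.
Proof. by have [] := set_valP g. Qed.

Lemma iso_surj (g : Iso) y : exists x, iso_fun g x = y.
Proof. by have [] := set_valP g. Qed.

Lemma iso_inj (g : Iso) : injective (iso_fun g).
Proof. by move=> x y gxy; apply: mdist_positivity; rewrite -(iso_mdist g) gxy mdistxx. Qed.

Lemma iso_ext (g h : Iso) : iso_fun g =1 iso_fun h -> g = h.
Proof. by move=> gh; apply: val_inj; exact/funext. Qed.

Definition mk_iso (f : U -> U) (fI : isometries f) : Iso := SigSub (mem_set fI).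

Fact iso_one_subproof : isometries (id : U -> U).
Proof. by split=> // y; exists y. Qed.

Fact iso_mul_subproof (g h : Iso) : isometries (iso_fun g \o iso_fun h).
Proof.
split=> [x y|y]; first by rewrite /= !iso_mdist.
by have [z <-] := iso_surj g y; have [x <-] := iso_surj h z; exists x.
Qed.

Definition iso_inv_fun (g : Iso) (y : U) : U := projT1 (cid (iso_surj g y)).

Fact iso_inv_funK (g : Iso) : cancel (iso_inv_fun g) (iso_fun g).
Proof. by move=> y; rewrite /iso_inv_fun; case: cid. Qed.

Fact iso_funK (g : Iso) : cancel (iso_fun g) (iso_inv_fun g).
Proof. by move=> x; apply: (@iso_inj g); rewrite iso_inv_funK. Qed.

Fact iso_inv_subproof (g : Iso) : isometries (iso_inv_fun g).
Proof.
split=> [x y|y]; first by rewrite -(iso_mdist g) !iso_inv_funK.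
by exists (iso_fun g y); exact: iso_funK.
Qed.

Definition iso_one : Iso := mk_iso iso_one_subproof.
Definition iso_mul (g h : Iso) : Iso := mk_iso (iso_mul_subproof g h).
Definition iso_inv (g : Iso) : Iso := mk_iso (iso_inv_subproof g).

Fact iso_mulA : associative iso_mul.
Proof. by move=> f g h; apply: iso_ext. Qed.

Fact iso_mul1 : left_id iso_one iso_mul.
Proof. by move=> g; apply: iso_ext. Qed.

Fact iso_mulr1 : right_id iso_one iso_mul.
Proof. by move=> g; apply: iso_ext. Qed.

Fact iso_mulV : left_inverse iso_one iso_inv iso_mul.
Proof. by move=> g; apply: iso_ext => x /=; exact: iso_funK. Qed.

Fact iso_mulrV : right_inverse iso_one iso_inv iso_mul.
Proof. by move=> g; apply: iso_ext => x /=; exact: iso_inv_funK. Qed.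

HB.instance Definition _ :=
  isGroup.Build Iso iso_mulA iso_mul1 iso_mulr1 iso_mulV iso_mulrV.

Lemma cvg_isoP (F : set_system Iso) (FF : Filter F) (g : Iso) :
  F --> g <-> forall x, iso_fun h x @[h --> F] --> iso_fun g x.
Proof.
transitivity (set_val h @[h --> F] --> (set_val g : {ptws U -> U})).
  split=> [Fg|Fg A].
    exact: cvg_trans (cvg_app _ Fg) (@initial_continuous _ _ _ g).
  move=> [_ [[B Bo <-] /= Bg] BA].
  have : F (set_val @^-1` B) by apply: Fg; exact: open_nbhs_nbhs.
  by apply: filterS => h /= /BA.
exact: pointwise_cvgP.
Qed.

Lemma cvg_iso_fun (g : Iso) x : iso_fun h x @[h --> g] --> iso_fun g x.
Proof. by have /cvg_isoP := @cvg_id _ (nbhs g); apply. Qed.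

Fact iso_mul_continuous : continuous (fun p : Iso * Iso => (p.1 * p.2)%g).
Proof.
move=> [g h] /=; apply/cvg_isoP => x.
apply/metricType_numDomainType.cvgrPdist_lt => e e0; rewrite near_map.
have e20 : 0 < e / 2 by rewrite divr_gt0.
have /metricType_numDomainType.cvgrPdist_lt/(_ _ e20) gP :=
  @cvg_iso_fun g (iso_fun h x).
have /metricType_numDomainType.cvgrPdist_lt/(_ _ e20) hP :=
  @cvg_iso_fun h x.
exists ([set g' | mdist (iso_fun g (iso_fun h x))
                        (iso_fun g' (iso_fun h x)) < e / 2],
        [set h' | mdist (iso_fun h x) (iso_fun h' x) < e / 2]); first by split.
move=> [g' h'] [/= gg' hh'].
rewrite [e]splitr (le_lt_trans (metric_triangle _ (iso_fun g' (iso_fun h x)) _))//.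
by rewrite ltrD//= iso_mdist.
Qed.

Fact iso_inv_continuous : continuous (fun g : Iso => (g^-1)%g).
Proof.
move=> g; apply/(cvg_isoP (fmap_filter _ (nbhs_filter g))) => x.
apply/metricType_numDomainType.cvgrPdist_lt => e e0; rewrite near_map.
have /metricType_numDomainType.cvgrPdist_lt/(_ _ e0) gP :=
  @cvg_iso_fun g (iso_inv_fun g x).
apply: filterS gP => h /=; rewrite iso_inv_funK => gh.
by rewrite -(iso_mdist h) iso_inv_funK metric_sym.
Qed.

HB.instance Definition _ :=
  isTopologicalGroup.Build Iso iso_mul_continuous iso_inv_continuous.

End isometry_group.

Section urysohn_sphere.
Context {R : realType}.

Definition diameter (T : metricType R) : \bar R :=
  ereal_sup [set (mdist x y)%:E | x in [set: T] & y in [set: T]].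

Definition separable (T : topologicalType) :=
  exists A : set T, countable A /\ dense A.

Definition complete (T : uniformType) :=
  forall F : set_system T, ProperFilter F -> cauchy F -> exists x : T, F --> x.

Definition homogeneous (T : metricType R) :=
  forall (A : set T) (f : T -> T), finite_set A ->
    (forall x y, A x -> A y -> mdist (f x) (f y) = mdist x y) ->
    exists g : Iso T, forall x, A x -> iso_fun g x = f x.

(* These properties determine the space up to isometry. *)
Definition is_urysohn_sphere (U : metricType R) :=
  [/\ separable U, complete U, diameter U = 1%E, homogeneous U &
      forall T : metricType R, countable [set: T] -> (diameter T <= 1)%E ->
        exists f : T -> U, forall x y, mdist (f x) (f y) = mdist x y].

End urysohn_sphere.

Section functions_on_group.
Context {R : realType} (G : topologicalGroupType).

Definition right_uniformly_continuous (h : G -> R) :=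
  forall e, 0 < e -> \forall g \near (1%g : G),
    forall x, `|h (g^-1 * x)%g - h x| < e.

Definition left_uniformly_continuous (h : G -> R) :=
  forall e, 0 < e -> \forall g \near (1%g : G),
    forall x, `|h (x * g)%g - h x| < e.

Definition UC : set (G -> R) := [set h |
  [/\ exists M, forall x, `|h x| <= M, continuous h,
      right_uniformly_continuous h & left_uniformly_continuous h]].

Definition continuous_action (Y : topologicalType) (act : G -> Y -> Y) :=
  [/\ forall y, act 1%g y = y,
      forall g g' y, act (g * g')%g y = act g (act g' y) &
      continuous (fun p : G * Y => act p.1 p.2)].

(* [nu] need not be injective. *)
Definition compactification (Y : topologicalType) (act : G -> Y -> Y)
    (nu : G -> Y) :=
  [/\ compact [set: Y], hausdorff_space Y, continuous_action act &
  [/\ continuous nu, forall g x, nu (g * x)%g = act g (nu x) &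
      dense (range nu)]].

Definition orbit_fun (Y : topologicalType) (act : G -> Y -> Y) (f : Y -> R) :
    set {ptws Y -> R} :=
  [set f \o act (g^-1)%g | g in [set: G]].

Definition sequentially_precompact (T : topologicalType) (A : set T) :=
  forall u : nat -> T, (forall n, A (u n)) ->
    exists (k : nat -> nat) (l : T),
      increasing_seq k /\ u (k n) @[n --> \oo] --> l.

(* Tameness is taken in its orbit form: for a compact [G]-space [Y] and
   continuous [f], [f] comes from a Rosenthal-representable compactification
   iff its orbit is sequentially precompact in [R^Y]. *)
Definition Tame : set (G -> R) := [set h |
  exists (Y : topologicalType) (act : G -> Y -> Y) (nu : G -> Y) (f : Y -> R),
  [/\ compactification act nu, continuous f, h = f \o nu &
      sequentially_precompact (orbit_fun act f)]].

End functions_on_group.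

Arguments UC {R} G.
Arguments Tame {R} G.

(* Main.v *)
(* A function [h] in [UC] depends, up to [eps], only on the matrix
   [mdist (a i) (x (a j))] for a suitable finite tuple [a].  Raise that matrix
   by [t], truncating at 1.  For [t > 0], the matrices raised by [t] and by
   [2t] can be prescribed independently against infinitely many translates
   [g n a] of [a]: placing distinct translates at distance [t] more than
   required is compatible with all triangle inequalities.  Tameness forbids
   such independence unless [h] takes nearly equal values on the two matrices.
   Uniform continuity fixes a first [t > 0] that changes [h] little; doubling
   it finitely often reaches the constant matrix 1, whatever [x] was.  The
   number of doublings depends only on this first [t], not on [a], so [a] may
   be enlarged afterwards to make the error of each doubling negligible. *)
From HB Require Import structures.
Require Import Defs.
From mathcomp Require Import all_boot all_order all_algebra.
From mathcomp Require Import all_classical all_reals all_analysis.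
From mathcomp Require Import lra zify.

Set Implicit Arguments.
Unset Strict Implicit.
Unset Printing Implicit Defensive.

Import Order.TTheory GRing.Theory Num.Theory.
Import numFieldNormedType.Exports.

Local Open Scope classical_set_scope.
Local Open Scope ring_scope.

(** * Pseudometrics, their sums and truncations *)

Definition pseudometric (R : realType) (I : Type) (d : I -> I -> R) :=
  [/\ forall i, d i i = 0, forall i j, d i j = d j i &
      forall i j k, d i k <= d i j + d j k].

Section pseudometric_theory.
Context {R : realType}.

Lemma pseudometric_ge0 (I : Type) (d : I -> I -> R) :
  pseudometric d -> forall i j, 0 <= d i j.
Proof.
move=> [d0 dC dt] i j; have := dt i j i.
by rewrite d0 (dC j i) => h; lra.
Qed.

Lemma pseudometric_mdist (T : metricType R) : pseudometric (@mdist R T).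
Proof. by split; [exact: mdistxx|exact: metric_sym|move=> *; exact: metric_triangle]. Qed.

Lemma pseudometric_comp (I J : Type) (f : I -> J) (d : J -> J -> R) :
  pseudometric d -> pseudometric (fun i j => d (f i) (f j)).
Proof. by move=> [d0 dC dt]; split. Qed.

Lemma pseudometric_add (I : Type) (d e : I -> I -> R) :
  pseudometric d -> pseudometric e -> pseudometric (fun i j => d i j + e i j).
Proof.
move=> [d0 dC dt] [e0 eC et]; split=> [i|i j|i j k].
- by rewrite d0 e0 addr0.
- by rewrite dC eC.
- by have := dt i j k; have := et i j k; lra.
Qed.

Lemma pseudometric_min1 (I : Type) (d : I -> I -> R) :
  pseudometric d -> pseudometric (fun i j => Num.min 1 (d i j)).
Proof.
move=> dP; have dge0 := pseudometric_ge0 dP.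
case: dP => d0 dC dt; split=> [i|i j|i j k].
- by rewrite d0 min_r.
- by rewrite dC.
- have := dt i j k; have := dge0 i j; have := dge0 j k.
  rewrite /Num.min; case: ifP => h1; case: ifP => h2; case: ifP => h3; lra.
Qed.

End pseudometric_theory.

(** * The countable metric space attached to a pseudometric *)

Section metric_quotient.
Context {R : realType} (I : countType) (d : I -> I -> R).
Context (dP : pseudometric d).

(** [choose] agrees on extensionally equal inhabited predicates, so all points of a class at mutual
    distance 0 get the same representative. *)
Definition representative (i : I) : I := choose (fun j => d i j == 0) i.

Lemma representative0 i : d i (representative i) = 0.
Proof. by apply/eqP/(@chooseP _ (fun j => d i j == 0)); case: dP => ->. Qed.

Lemma pseudometric_representative i j :
  d (representative i) (representative j) = d i j.
Proof.
have [d0 dC dt] := dP; have hi := representative0 i; have hj := representative0 j.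
apply/eqP; rewrite eq_le; apply/andP; split.
  have := dt (representative i) i (representative j).
  have := dt i j (representative j).
  by rewrite hj (dC (representative i) i) hi => ? ?; lra.
have := dt i (representative i) j; have := dt (representative i) (representative j) j.
by rewrite hi (dC (representative j) j) hj => ? ?; lra.
Qed.

Lemma representative_eq i j : d i j = 0 -> representative i = representative j.
Proof.
move=> dij; have [d0 dC dt] := dP.
have E : (fun k => d i k == 0) =1 (fun k => d j k == 0).
  move=> k; have := pseudometric_ge0 dP i k; have := pseudometric_ge0 dP j k.
  have := dt i j k; have := dt j i k; rewrite dij (dC j i) dij => *.
  by apply/eqP/eqP => ?; lra.
rewrite /representative (eq_choose E); apply: choose_id; last by rewrite d0.
by rewrite -E d0.
Qed.

Lemma representativeK i : representative (representative i) = representative i.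
Proof. by apply/esym/representative_eq; rewrite representative0. Qed.

(** A subtype of [I], so that countability is inherited. *)
Definition metric_quotient of pseudometric d : Type :=
  {i : I | representative i == i}.

HB.instance Definition _ := Countable.copy (metric_quotient dP)
  {i : I | representative i == i}.

Definition quotient_dist (x y : metric_quotient dP) : R := d (val x) (val y).

Fact quotient_distxx x : quotient_dist x x = 0.
Proof. by case: dP => d0 _ _; exact: d0. Qed.

Fact quotient_dist_positivity x y : quotient_dist x y = 0 -> x = y.
Proof.
move=> /representative_eq; case: x y => [x xP] [y yP] /= E.
by apply: val_inj; rewrite /= -(eqP xP) -(eqP yP).
Qed.

Fact quotient_dist_sym x y : quotient_dist x y = quotient_dist y x.
Proof. by case: dP => _ dC _; exact: dC. Qed.

Fact quotient_dist_triangle y x z :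
  quotient_dist x z <= quotient_dist x y + quotient_dist y z.
Proof. by case: dP => _ _ dt; exact: dt. Qed.

HB.instance Definition _ := @isMetric.Build R (metric_quotient dP)
  quotient_dist quotient_distxx quotient_dist_positivity
  quotient_dist_sym quotient_dist_triangle.

Definition quotient_class (i : I) : metric_quotient dP :=
  exist _ (representative i) (introT eqP (representativeK i)).

Lemma mdist_quotient_class i j :
  mdist (quotient_class i) (quotient_class j) = d i j.
Proof. exact: pseudometric_representative. Qed.

End metric_quotient.

(** * Extension of finite configurations in the Urysohn sphere *)

Section urysohn_extension.
Context {R : realType} (U : metricType R).
Context (hU : is_urysohn_sphere U).

Lemma urysohn_mdist_le1 (x y : U) : mdist x y <= 1.
Proof.
case: hU => _ _ dU _ _; rewrite -lee_fin -dU; apply: ereal_sup_ubound.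
by exists x => //; exists y.
Qed.

(** Tuples may repeat points: if [p i = p j], then [q i] and [q j] are at distance 0, so [p i]
    determines [q i]. *)
Lemma urysohn_homogeneous (I : Type) (P : set I) (p q : I -> U) :
  finite_set P ->
  (forall i j, P i -> P j -> mdist (p i) (p j) = mdist (q i) (q j)) ->
  exists g : Iso U, forall i, P i -> iso_fun g (p i) = q i.
Proof.
move=> finP pq; case: hU => _ _ _ hom _.
pose f x := if pselect (exists2 i, P i & p i = x) is left e
            then q (projT1 (cid2 e)) else x.
have fE i : P i -> f (p i) = q i.
  move=> Pi; rewrite /f; case: pselect => [e|]; last by case; exists i.
  case: cid2 => j /= Pj pji; apply: mdist_positivity.
  by rewrite -pq// pji mdistxx.
have [] := hom (p @` P) f (finite_image _ finP).
  by move=> _ _ [i Pi <-] [j Pj <-]; rewrite !fE// pq.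
by move=> g gf; exists g => i Pi; rewrite gf ?fE//; exists i.
Qed.

(** Universality embeds the metric quotient of [d]; homogeneity then moves the finitely many indices
    in [P] to their prescribed points. *)
Lemma urysohn_extension (I : countType) (d : I -> I -> R) (P : set I)
    (p : I -> U) :
  pseudometric d -> (forall i j, d i j <= 1) -> finite_set P ->
  (forall i j, P i -> P j -> mdist (p i) (p j) = d i j) ->
  exists r : I -> U, (forall i, P i -> r i = p i) /\
    forall i j, mdist (r i) (r j) = d i j.
Proof.
move=> dP d1 finP pd; case: (hU) => _ _ _ _ /(_ (metric_quotient dP)).
have cT : countable [set: metric_quotient dP] by exact: countableP.
have dT : (diameter (metric_quotient dP) <= 1)%E.
  by apply: ge_ereal_sup => _ [x _] [y _ <-]; rewrite lee_fin; exact: d1.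
move=> /(_ cT dT)[f fP].
have [|g gP] := @urysohn_homogeneous I P (f \o quotient_class dP) p finP.
  by move=> i j Pi Pj /=; rewrite fP mdist_quotient_class pd.
exists (iso_fun g \o f \o quotient_class dP); split=> [i Pi|i j] /=.
  exact: gP.
by rewrite iso_mdist fP mdist_quotient_class.
Qed.

Definition truncated (I : Type) (q : I -> U) (e : I -> I -> R) (i j : I) : R :=
  Num.min 1 (mdist (q i) (q j) + e i j).

Lemma urysohn_truncated_extension (I : countType) (q : I -> U)
    (e : I -> I -> R) (P : set I) (p : I -> U) :
  pseudometric e -> finite_set P ->
  (forall i j, P i -> P j -> mdist (p i) (p j) = truncated q e i j) ->
  exists r : I -> U, (forall i, P i -> r i = p i) /\
    forall i j, mdist (r i) (r j) = truncated q e i j.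
Proof.
move=> eP finP pe; apply: urysohn_extension => //.
- apply: pseudometric_min1; apply: pseudometric_add => //.
  exact/pseudometric_comp/pseudometric_mdist.
- by move=> i j; rewrite /truncated ge_min lexx.
Qed.

(** The filter generated by these sets converges pointwise to the identity, hence contains all its
    neighbourhoods. *)
Lemma iso_nbhs1 (A : set (Iso U)) : nbhs (1%g : Iso U) A ->
  exists (s : seq U) (del : R), 0 < del /\
    forall g, (forall a, a \in s -> mdist a (iso_fun g a) < del) -> A g.
Proof.
pose F := filter_from [set p : seq U * R | 0 < p.2]
  (fun p => [set g : Iso U | forall a, a \in p.1 -> mdist a (iso_fun g a) < p.2]).
have FF : Filter F.
  apply: filter_from_filter; first by exists ([::], 1) => /=.
  move=> [s d] [s' d'] /= d0 d'0; exists (s ++ s', Num.min d d') => /=.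
    by rewrite lt_min d0 d'0.
  move=> g gP; split=> a ain.
    by have := gP a; rewrite mem_cat ain lt_min => /(_ isT)/andP[].
  by have := gP a; rewrite mem_cat ain orbT lt_min => /(_ isT)/andP[].
have : F --> (1%g : Iso U).
  apply/(cvg_isoP FF) => x; apply/metricType_numDomainType.cvgrPdist_lt => e e0.
  exists ([:: x], e) => //= g; apply; exact: mem_head.
by move=> F1 /F1[[s d] /= d0 sA]; exists s, d.
Qed.

End urysohn_extension.

(** * Tameness against independence *)

(** Along a convergent subsequence of translates, let [S] alternate: at one point of [Y], the limit
    is then within [eps] of both [alpha] and [beta]. *)
Lemma tame_no_independence (R : realType) (G : topologicalGroupType) (h : G -> R)
    (g : nat -> G) (alpha beta eps : R) :
  Tame G h ->
  (forall (S : set nat) N, exists y : G, forall n, (n < N)%N ->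
     `|h ((g n)^-1 * y)%g - (if n \in S then alpha else beta)| <= eps) ->
  `|alpha - beta| <= eps *+ 2.
Proof.
move=> [Y [act [nu [f [[cY _ [act1 actM actc] [_ nuM _]] cf -> spc]]]]] indep.
have actc1 x : continuous (act x).
  move=> y; apply: (@continuous_comp Y (G * Y)%type Y (fun y => (x, y))
    (fun p => act p.1 p.2)); last exact: actc.
  by apply: cvg_pair => //; exact: cvg_cst.
have [k [l [kincr kl]]] := spc (fun n => f \o act (g n)^-1%g) (fun n => ex_intro2 _ _ _ I erefl).
(* Even terms of the subsequence aim at [alpha]; odd ones at [beta], since [k] is injective. *)
pose S := [set n | exists j, n = k j.*2].
have [y yP] := choice (indep S).
pose F := nu (y N) @[N --> \oo].
(* Each constraint is closed in [Y] and holds for [y N] once [N] is large, so a cluster point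
   satisfies all of them. *)
have [//|z [_ zF]] := cY F _ _; first by exact: filterT.
have fz n : `|f (act (g n)^-1%g z) - (if n \in S then alpha else beta)| <= eps.
  set c := (if _ then _ else _).
  have cphi : continuous (fun y => `|f (act (g n)^-1%g y) - c|).
    move=> t; apply: cvg_norm; apply: cvgB; last exact: cvg_cst.
    by apply: (continuous_comp (actc1 _ t)); exact: cf.
  have cA : closed [set t | `|f (act (g n)^-1%g t) - c| <= eps].
    by apply: (@closed_comp _ _ _ [set x | x <= eps]) => [t _|]; [exact: cphi|exact: closed_le].
  apply: cA => B /zF; apply; exists n.+1 => // N /= nN.
  by have := yP N n nN; rewrite /= nuM.
have kl_z : f (act (g (k n))^-1%g z) @[n --> \oo] --> l z.
  by move/pointwise_cvgP : kl => /(_ z).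
have near_l (a : nat -> nat) c : (forall j, (j <= a j)%N) ->
    (forall j, (if k (a j) \in S then alpha else beta) = c) -> `|l z - c| <= eps.
  move=> ja aS.
  have : `|f (act (g (k (a j)))^-1%g z) - c| @[j --> \oo] --> `|l z - c|.
    apply: cvg_norm; apply: cvgB; last exact: cvg_cst.
    apply: (cvg_comp _ _ _ kl_z) => A [N _ NA].
    by exists N => // j /= Nj; apply: NA => /=; exact: leq_trans (ja j).
  move=> cl; rewrite -(cvg_lim _ cl)//; apply: limr_le; first by apply/cvg_ex; eexists; exact: cl.
  by apply: nearW => j; rewrite -(aS j).
have kinj i j : k i = k j -> i = j.
  by move=> kij; apply: anti_leq; rewrite -!kincr kij lexx.
have la : `|l z - alpha| <= eps.
  apply: (near_l double) => j; first by rewrite -addnn leq_addr.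
  by rewrite ifT//; apply/mem_set; exists j.
have lb : `|l z - beta| <= eps.
  apply: (near_l (fun j => j.*2.+1)) => j; first by rewrite leqW// -addnn leq_addr.
  rewrite ifF//; apply/negbTE/negP => /set_mem[i /kinj E].
  by have := congr1 odd E; rewrite /= !odd_double.
rewrite mulr2n -[alpha - beta](subrKA (l z)) (le_trans (ler_normD _ _))//.
by rewrite lerD// distrC.
Qed.

(** * Displacement matrices and their raised forms *)

Section displacement_matrix.
Context {R : realType} (U : metricType R).
Context (hU : is_urysohn_sphere U).

Lemma iso_fun_mul (g g' : Iso U) x :
  iso_fun (g * g')%g x = iso_fun g (iso_fun g' x).
Proof. by []. Qed.

Lemma iso_fun_inv_eq (g : Iso U) x y : iso_fun g x = y -> iso_fun g^-1%g y = x.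
Proof. by move=> <-; exact: iso_funK. Qed.

Lemma mdist_iso_inv (g : Iso U) x y :
  mdist x (iso_fun g^-1%g y) = mdist (iso_fun g x) y.
Proof. by rewrite -(iso_mdist g); congr mdist; exact: iso_inv_funK. Qed.

Lemma truncated0 (I : Type) (q : I -> U) (e : I -> I -> R) i j :
  e i j = 0 -> truncated q e i j = mdist (q i) (q j).
Proof. by move=> e0; rewrite /truncated e0 addr0 min_r ?urysohn_mdist_le1. Qed.

Context (K : finType) (a : K -> U) (h : Iso U -> R) (eps : R).

Definition displacement (x : Iso U) (i j : K) : R :=
  mdist (a i) (iso_fun x (a j)).

Definition raised (x : Iso U) (t : R) (z : Iso U) :=
  forall i j, displacement z i j = Num.min 1 (displacement x i j + t).

(** Adjoin to [a] and [x a] a second copy of [x a], all cross distances being raised by [t] and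
    truncated; [z] carries [a] to the new copy. *)
Lemma raised_exists x t : 0 <= t -> exists z, raised x t z /\
  forall k, mdist (iso_fun x (a k)) (iso_fun z (a k)) <= t.
Proof.
move=> t0.
pose new (i : bool * K + K) := if i is inr _ then true else false.
pose e i j := if new i == new j then 0 else t.
pose q i := match i with
  | inl (false, k) => a k | inl (true, k) | inr k => iso_fun x (a k) end.
have eP : pseudometric e.
  split=> [i|i j|i j k]; first by rewrite /e eqxx.
    by rewrite /e eq_sym.
  by rewrite /e; case: (new i) (new j) (new k) => [] [] []; rewrite /=; lra.
have finP : finite_set [set i | new i = false] by exact: finite_finset.
have [|r [rP rd]] := @urysohn_truncated_extension _ _ hU _ q e _ q eP finP.
  by move=> i j /= ni nj; rewrite truncated0// /e ni nj.
have [|z zr] := @urysohn_homogeneous _ _ hU K setT a (r \o inr) finite_finset.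
  by move=> i j _ _ /=; rewrite rd truncated0//= iso_mdist.
have ra k : r (inl (false, k)) = a k by exact: rP.
have rx k : r (inl (true, k)) = iso_fun x (a k) by exact: rP.
exists z; split=> [i j|k].
  by rewrite /displacement zr//= -[in LHS]ra rd /truncated /e.
rewrite zr//= -rx rd /truncated mdistxx /e /= add0r.
by rewrite ge_min lexx orbT.
Qed.

Context (h_stab : forall g : Iso U, (forall k, iso_fun g (a k) = a k) ->
  forall x, `|h (g^-1 * x)%g - h x| < eps /\ `|h (x * g)%g - h x| < eps).

(** Some [g] fixes [a] and carries [x a] to [y a], so [y = g * x * v] with [v] also fixing [a]; each
    of the two factors costs [eps]. *)
Lemma displacement_close x y : displacement x =2 displacement y ->
  `|h x - h y| <= eps *+ 2.
Proof.
move=> xy.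
pose p (z : Iso U) (i : K + K) :=
  match i with inl k => a k | inr k => iso_fun z (a k) end.
have [|g gP] := @urysohn_homogeneous _ _ hU _ setT (p x) (p y) finite_finset.
  move=> [i|i] [j|j] _ _ //=; [exact: xy| |by rewrite !iso_mdist].
  by rewrite metric_sym [RHS]metric_sym; exact: xy.
have ga k : iso_fun g (a k) = a k by exact: (gP (inl k)).
have gx k : iso_fun g (iso_fun x (a k)) = iso_fun y (a k) by exact: (gP (inr k)).
pose v := ((g * x)^-1 * y)%g.
have va k : iso_fun v (a k) = a k by rewrite iso_fun_mul; apply: iso_fun_inv_eq; exact: gx.
have [h1 _] := h_stab ga (g * x)%g; have [_ h2] := h_stab va (g * x)%g.
rewrite monoid.mulKg in h1; rewrite /v monoid.mulVKg in h2.
have -> : h x - h y = (h x - h (g * x)%g) - (h y - h (g * x)%g) by lra.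
by rewrite mulr2n (le_trans (ler_normB _ _))// lerD// ltW.
Qed.

Context (h_tame : Tame (Iso U) h).

Lemma raised_doubling_close x t z z' : 0 < t ->
  raised x t z -> raised x (t *+ 2) z' -> `|h z - h z'| <= eps *+ 4.
Proof.
move=> t0 zt z't.
(* The extra distance [t] between distinct translates absorbs the gap between [t] and [t *+ 2]. *)
pose e0 (i j : nat * K) := if i.1 == j.1 then 0 else t.
have e0P : pseudometric e0.
  split=> [i|i j|i j k]; first by rewrite /e0 eqxx.
    by rewrite /e0 eq_sym.
  rewrite /e0; case: (eqVneq i.1 j.1) => [->|_]; first by lra.
  by case: (eqVneq j.1 k.1) => [_|_]; case: ifP => _; lra.
have [//|b [_ bd]] := @urysohn_truncated_extension _ _ hU _ (a \o snd) e0 set0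
  (a \o snd) e0P (finite_set0 _).
have /choice[g gP] n : exists g : Iso U, forall k, iso_fun g (a k) = b (n, k).
  have [|g gP] := @urysohn_homogeneous _ _ hU K setT a (fun k => b (n, k)) finite_finset.
    by move=> i j _ _; rewrite bd truncated0// /e0 eqxx.
  by exists g => k; exact: gP.
(* The inner [eps *+ 2] comes from [displacement_close]; the independence lemma doubles it. *)
have -> : eps *+ 4 = (eps *+ 2) *+ 2 by rewrite -mulrnA.
apply: (tame_no_independence (g := g) h_tame) => S N.
pose tau n := if n \in S then t else t *+ 2.
(* The colour [Some n] carries the translate [g n a], [None] the unknown
   tuple [y a]; [tau n] lies between [t] and [2t], hence [e] is a pseudometric. *)
pose e (i j : option nat * K) := match i.1, j.1 with
  | Some n, Some m => if n == m then 0 else t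
  | Some n, None | None, Some n => tau n
  | None, None => 0 end.
have eP : pseudometric e.
  have tauP n : t <= tau n <= t *+ 2 by rewrite /tau; case: ifP => _; lra.
  split=> [[[n|] i]|[[n|] i] [[m|] j]|[[n|] i] [[m|] j] [[l|] k]] //=; rewrite /e /=.
  - by rewrite eqxx.
  - by rewrite eq_sym.
  - case: (eqVneq n m) => [->|_]; first by lra.
    by case: (eqVneq m l) => [_|_]; case: ifP => _; lra.
  - have := tauP n; have := tauP m; case: (eqVneq n m) => [->|_]; first by lra.
    by lra.
  - have := tauP n; have := tauP l; case: (eqVneq n l) => [->|_]; lra.
  - by lra.
  - have := tauP l; have := tauP m; case: (eqVneq m l) => [->|_]; first by lra.
    by lra.
  - by have := tauP m; lra.
  - by lra.
  - by lra.
pose q (i : option nat * K) := if i.1 is Some _ then a i.2 else iso_fun x (a i.2).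
pose p (i : option nat * K) := if i.1 is Some n then b (n, i.2) else a i.2.
pose P := [set i : option nat * K | if i.1 is Some n then (n < N)%N else false].
have finP : finite_set P.
  apply: (@sub_finite_set _ _ ((fun i : nat * K => (Some i.1, i.2)) @` (`I_N `*` setT))).
    by move=> [[n|] k] //= nN; exists (n, k).
  by apply/finite_image/finite_setX => //; exact: finite_finset.
have [|r [rP rd]] := @urysohn_truncated_extension _ _ hU _ q e P p eP finP.
  by move=> [[n|] i] [[m|] j] //= _ _; rewrite bd.
(* [e] vanishes within the colour [None], so that tuple is isometric to [a]. *)
have [|y yr] := @urysohn_homogeneous _ _ hU K setT a (fun k => r (None, k)) finite_finset.
  by move=> i j _ _; rewrite rd truncated0// iso_mdist.
exists y => n nN.
have yn : raised x (tau n) ((g n)^-1 * y)%g.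
  move=> i j; rewrite /displacement iso_fun_mul mdist_iso_inv gP yr//.
  have <- : r (Some n, i) = b (n, i) by exact: (rP (Some n, i)).
  by rewrite rd.
move: yn; rewrite /tau; case: ifP => _ yn.
  by apply: displacement_close => i j; rewrite yn zt.
by apply: displacement_close => i j; rewrite yn z't.
Qed.

(** Equal matrices cost [eps *+ 2], and each of the [n] doublings [eps *+ 4]. *)
Lemma raised_chain_close x t n z z' : 0 < t ->
  raised x t z -> raised x (t *+ 2 ^ n) z' -> `|h z - h z'| <= eps *+ (4 * n + 2).
Proof.
move=> t0 zt; elim: n z' => [|n IH] z' z't.
  by apply: displacement_close => i j; rewrite zt z't.
have [|w [wt _]] := @raised_exists x (t *+ 2 ^ n); first by rewrite mulrn_wge0 ?ltW.
have h1 := IH _ wt.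
have h2 : `|h w - h z'| <= eps *+ 4.
  apply: (@raised_doubling_close x (t *+ 2 ^ n)) => //.
    by rewrite pmulrn_lgt0// expn_gt0.
  by rewrite -mulrnA -expnSr.
rewrite -[h z - _](subrKA (h w)) (le_trans (ler_normD _ _))//.
have -> : (4 * n.+1 + 2 = (4 * n + 2) + 4)%N by lia.
by rewrite mulrnDr lerD.
Qed.

End displacement_matrix.

(** * Comparison of all values through the constant matrix 1 *)

Theorem theorem4p13 (R : realType) (U : metricType R)
    (hU : is_urysohn_sphere U) (h : Iso U -> R)
    (hh : (Tame (Iso U) `&` UC (Iso U)) h) :
  exists c : R, forall g : Iso U, h g = c.
Proof.
case: hh => h_tame [_ _ h_right h_left].
(* The estimates below add up to [eta *+ 5], so 8 leaves room. *)
suff close (eta : R) x y : 0 < eta -> `|h x - h y| <= eta *+ 8.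
  exists (h 1%g) => g; apply/eqP; rewrite -subr_eq0 -normr_le0.
  apply/ler_addgt0Pr => e e0; rewrite add0r.
  rewrite [leRHS](_ : e = (e / 8) *+ 8); last by rewrite -[RHS]mulr_natr divfK.
  by apply: close; rewrite divr_gt0.
move=> eta0.
(* [del], [t] and [n] depend only on [eta]; [eps] and the second tuple [s'] are chosen after [n]. *)
have [s [del [del0 sP]]] := iso_nbhs1 (h_left _ eta0).
pose t := del / 2.
have t0 : 0 < t by rewrite divr_gt0.
have [n tn] : exists n, 1 <= t *+ 2 ^ n.
  exists (Num.bound t^-1).
  rewrite -mulr_natl -ler_pdivrMr// div1r.
  rewrite (le_trans (ltW (archi_boundP _)))// ?invr_ge0 ?ltW//.
  by rewrite ltr_nat ltn_expl.
pose eps := eta / (4 * n + 2)%:R.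
have eps0 : 0 < eps by rewrite divr_gt0// ltr0n addn2.
have epsE : eps *+ (4 * n + 2) = eta by rewrite -mulr_natr divfK// pnatr_eq0 addn2.
have [s' [del' [del'0 s'P]]] := iso_nbhs1 (filterI (h_right _ eps0) (h_left _ eps0)).
(* The tuple joins [s], which controls the first raise by [t], to [s'], which gives stability up to
   [eps]. *)
pose K := seq_sub (s ++ s'); pose a : K -> U := @ssval _ _.
have h_stab (g : Iso U) : (forall k, iso_fun g (a k) = a k) ->
    forall x, `|h (g^-1 * x)%g - h x| < eps /\ `|h (x * g)%g - h x| < eps.
  move=> ga; have [|gr gl] := s'P g; last by move=> z; split; [exact: gr|exact: gl].
  move=> u us'; have uK : u \in s ++ s' by rewrite mem_cat us' orbT.
  by rewrite (ga (SeqSub uK)) mdistxx.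
have far w : exists2 w', (forall i j, displacement a w' i j = 1) & `|h w - h w'| <= eta *+ 2.
  have [z [zt wz]] := raised_exists hU a w (ltW t0).
  have [w' [w't _]] := @raised_exists _ _ hU _ a w (t *+ 2 ^ n) (mulrn_wge0 _ (ltW t0)).
  exists w' => [i j|].
    by rewrite w't min_l// (le_trans tn)// lerDr mdist_ge0.
  rewrite -[h w - _](subrKA (h z)) mulr2n (le_trans (ler_normD _ _))// lerD//.
    (* [z] moves each point of the tuple at most [t = del / 2] away from its image under [w], so
       right multiplication by [w^-1 * z] changes [h w] by less than [eta]. *)
    have near1 u : u \in s -> mdist u (iso_fun (w^-1 * z)%g u) < del.
      move=> us; have uK : u \in s ++ s' by rewrite mem_cat us.
      rewrite iso_fun_mul mdist_iso_inv (le_lt_trans (wz (SeqSub uK)))//.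
      by rewrite /t ltr_pdivrMr// ltr_pMr// ltr1n.
    by have := sP _ near1 w; rewrite monoid.mulVKg distrC => /ltW.
  by rewrite -epsE; exact: (raised_chain_close hU h_stab h_tame t0 zt w't).
have [x' x'1 xx'] := far x; have [y' y'1 yy'] := far y.
have x'y' : `|h x' - h y'| <= eps *+ 2.
  by apply: (displacement_close hU h_stab) => i j; rewrite x'1 y'1.
have e2 : eps *+ 2 <= eta by rewrite -epsE ler_wpMn2l ?ltW// leq_addl.
have -> : h x - h y = (h x - h x') + (h x' - h y') - (h y - h y') by lra.
rewrite (le_trans (ler_normB _ _))//; have := ler_normD (h x - h x') (h x' - h y').
by lra.
Qed.
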